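(* Let $p_0=0$ and let $p_1,p_2,p_3\in\mathbb H$ be real-linearly independent. With $V$, $V_{\mathbb C}$, $G$, $b(Q)$, $W(Q)$, $\Delta_A$ as in the context, put $R_j(W)=\langle W-p_j,W-p_j\rangle$ for $W\in V_{\mathbb C}$ and $j=0,1,2,3$, and define \[ \Theta:V_{\mathbb C}\times\mathbb C\to\mathbb C^4,\qquad \Theta(W,S)=\bigl(R_0(W)+S,\;R_1(W)+S,\;R_2(W)+S,\;R_3(W)+S\bigr). \] The map $\Theta$ is a polynomial isomorphism (a bijective polynomial map with polynomial inverse). Its inverse is $Q\mapsto (W(Q),\Delta_A(Q))$. In particular, $\Delta_A(\Theta(W,S))=S$ for all $(W,S)\in V_{\mathbb C}\times\mathbb C$.
   Context: $\mathbb H$ is the real quaternion algebra, identified with Euclidean $\mathbb R^4$; $\mathbb H_{\mathbb C}=\mathbb H\otimes_{\mathbb R}\mathbb C$, and $\langle\cdot,\cdot\rangle$ is the complex-bilinear extension to $\mathbb H_{\mathbb C}$ of the Euclidean inner product of $\mathbb H$. $V=\operatorname{span}_{\mathbb R}\{p_1,p_2,p_3\}$, $V_{\mathbb C}=V\otimes_{\mathbb R}\mathbb C\subset\mathbb H_{\mathbb C}$, and $G=(\langle p_i,p_j\rangle)_{1\le i,j\le3}$ is the (positive definite) Gram matrix. For $Q=(Q_0,Q_1,Q_2,Q_3)\in\mathbb C^4$ put $b_j(Q)=\frac12(Q_0+\|p_j\|^2-Q_j)$ for $j=1,2,3$, $b(Q)=(b_1(Q),b_2(Q),b_3(Q))^T$,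 $W(Q)=\sum_{i,k=1}^3(G^{-1})_{ik}b_k(Q)p_i\in V_{\mathbb C}$, and $\Delta_A(Q)=Q_0-b(Q)^TG^{-1}b(Q)$. *)

(* Defs.v *)
From HB Require Import structures.
From mathcomp Require Import all_boot all_order all_algebra.
From mathcomp Require Import reals complex mpoly.

Set Implicit Arguments.
Unset Strict Implicit.
Unset Printing Implicit Defensive.

Import GRing.Theory Num.Theory.
Local Open Scope ring_scope.

Section PolynomialMaps.
Variable K : fieldType.

(* Stated in the coordinates of the library's basis [vbasis] of each full
   space; the notion does not depend on the choice of bases. *)
Definition polynomial_map (U T : vectType K) (f : U -> T) : Prop :=
  forall i : 'I_(\dim {:T}), exists P : {mpoly K[\dim {:U}]},
    forall u : U,
      coord (vbasis {:T}) i (f u) = P.@[fun k => coord (vbasis {:U}) k u].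

Definition polynomial_isomorphism (U T : vectType K) (f : U -> T) : Prop :=
  polynomial_map f /\
  exists g : T -> U, [/\ cancel f g, cancel g f & polynomial_map g].

End PolynomialMaps.

(* Bilinear even over [R[i]]: no complex conjugation. *)
Definition dot (K : pzRingType) (n : nat) (u v : 'rV[K]_n) : K :=
  \sum_(k < n) u 0 k * v 0 k.

Section Complexification.
Variables (R : realType) (n : nat).

Definition cplx (v : 'rV[R]_n) : 'rV[R[i]]_n := map_mx (real_complex R) v.

(* The image of the injection of V tensor C into C^n, i.e. the complex span of
   the vectors of V. *)
Definition cspan (V : {vspace 'rV[R]_n}) : {vspace 'rV[R[i]]_n} :=
  <<[seq cplx v | v <- vbasis V]>>%VS.

Lemma cplx_cspan (V : {vspace 'rV[R]_n}) v : v \in V -> cplx v \in cspan V.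
Proof.
move=> vV; rewrite (coord_vbasis vV) /cplx raddf_sum /=.
apply: rpred_sum => i _; rewrite map_mxZ; apply: rpredZ.
by apply: memv_span; apply: map_f; apply: mem_nth; rewrite size_tuple.
Qed.

End Complexification.

Section Theta.
Variable R : realType.

(* The real quaternions and their complexification, through the identification
   of the basis 1, i, j, k with the standard basis; quaternion multiplication
   plays no role here. *)
Local Notation H := 'rV[R]_4.
Local Notation HC := 'rV[R[i]]_4.

(* [p j] is $p_j$ for j = 0, ..., 3; the index i : 'I_3 stands for i + 1. *)
Variable p : 'I_4 -> H.

Definition p123 : 3.-tuple H := [tuple p (lift ord0 i) | i < 3].

Definition V : {vspace H} := <<p123>>%VS.
Definition VC : {vspace HC} := cspan V.

Definition G : 'M[R]_3 := \matrix_(i, j) dot (tnth p123 i) (tnth p123 j).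
Definition invGC : 'M[R[i]]_3 := map_mx (real_complex R) (invmx G).

Definition b (Q : 'rV[R[i]]_4) : 'cV[R[i]]_3 :=
  \col_j (2^-1 * (Q 0 ord0 + (dot (tnth p123 j) (tnth p123 j))%:C%C
                  - Q 0 (lift ord0 j))).

Definition Wvec (Q : 'rV[R[i]]_4) : HC :=
  \sum_(i < 3) \sum_(k < 3) (invGC i k * b Q k 0) *: cplx (tnth p123 i).

Lemma Wvec_VC Q : Wvec Q \in VC.
Proof.
apply: rpred_sum => i _; apply: rpred_sum => k _; apply: rpredZ.
by apply: cplx_cspan; apply: memv_span; apply: mem_tnth.
Qed.

Definition W (Q : 'rV[R[i]]_4) : subvs_of VC := Subvs (Wvec_VC Q).

Definition DeltaA (Q : 'rV[R[i]]_4) : R[i] :=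
  Q 0 ord0 - ((b Q)^T *m invGC *m b Q) 0 0.

Definition Rj (j : 'I_4) (w : subvs_of VC) : R[i] :=
  dot (vsval w - cplx (p j)) (vsval w - cplx (p j)).

Definition Theta (x : subvs_of VC * R[i]^o) : 'rV[R[i]]_4 :=
  \row_j (Rj j x.1 + x.2).

Definition ThetaInv (Q : 'rV[R[i]]_4) : subvs_of VC * R[i]^o := (W Q, DeltaA Q).

End Theta.

(* Main.v *)
(** Let $P$ be the 3 x 4 matrix whose rows are $p_1, p_2, p_3$, so that
    $G = P P^T$. For $Q = \Theta(w, S)$ the quadratic terms cancel in
    $Q_0 + \|p_j\|^2 - Q_j$, leaving $b(Q) = P w^T$; since $w = c P$ for some
    row $c$, this gives $G^{-1} b(Q) = c^T$, which recovers first $w$ and then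
    $S = Q_0 - \langle w, w\rangle$. Conversely $W(Q) = (G^{-1} b(Q))^T P$
    satisfies $P W(Q)^T = b(Q)$ and
    $\langle W(Q), W(Q)\rangle = b(Q)^T G^{-1} b(Q)$, so $\Theta$ sends
    $(W(Q), \Delta_A(Q))$ back to $Q$. *)

Require Import Defs.
From HB Require Import structures.
From mathcomp Require Import all_boot all_order all_algebra.
From mathcomp Require Import reals complex mpoly.
From mathcomp Require Import ring.

Set Implicit Arguments.
Unset Strict Implicit.
Unset Printing Implicit Defensive.

Import GRing.Theory Num.Theory.
Local Open Scope ring_scope.

(** * Closure properties of polynomial functions *)

Section PolynomialFunctions.
Variables (K : fieldType) (U : vectType K).

(** Scalar-valued counterpart of [polynomial_map]: products make sense here, so closure under the
    ring operations is proved once and then used coordinate by coordinate. *)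
Definition polynomial_fun (f : U -> K) : Prop :=
  exists P : {mpoly K[\dim {:U}]},
    forall u : U, f u = P.@[fun k => coord (vbasis {:U}) k u].

Lemma polynomial_fun_cst (c : K) : polynomial_fun (fun=> c).
Proof. by exists c%:MP => u; rewrite mevalC. Qed.

Lemma polynomial_funD (f g : U -> K) :
  polynomial_fun f -> polynomial_fun g -> polynomial_fun (fun u => f u + g u).
Proof. by move=> [P fP] [Q gQ]; exists (P + Q) => u; rewrite mevalD fP gQ. Qed.

Lemma polynomial_funM (f g : U -> K) :
  polynomial_fun f -> polynomial_fun g -> polynomial_fun (fun u => f u * g u).
Proof. by move=> [P fP] [Q gQ]; exists (P * Q) => u; rewrite mevalM fP gQ. Qed.

Lemma polynomial_funB (f g : U -> K) :
  polynomial_fun f -> polynomial_fun g -> polynomial_fun (fun u => f u - g u).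
Proof. by move=> [P fP] [Q gQ]; exists (P - Q) => u; rewrite mevalB fP gQ. Qed.

Lemma polynomial_fun_sum (I : finType) (F : I -> U -> K) :
  (forall i, polynomial_fun (F i)) -> polynomial_fun (fun u => \sum_i F i u).
Proof.
move=> FP; have [P PE] := fin_all_exists FP.
by exists (\sum_i P i) => u; rewrite raddf_sum; apply: eq_bigr => i _; apply: PE.
Qed.

(** The witness is the linear form whose coefficients are the values of $f$ on the basis vectors. *)
Lemma polynomial_fun_scalar (f : U -> K) : scalar f -> polynomial_fun f.
Proof.
move=> f_lin.
have f_0 : f 0 = 0.
  by have := f_lin (-1) 0 0; rewrite scaler0 addr0 mulN1r addNr.
exists (\sum_(k < \dim {:U}) f (vbasis {:U})`_k *: 'X_k) => u.
rewrite [in LHS](coord_vbasis (memvf u)) raddf_sum /=.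
under [RHS]eq_bigr do rewrite mevalZ mevalXU.
elim/big_rec2: _ => // k y1 y2 _ <-.
by rewrite f_lin mulrC.
Qed.

(** Each coordinate of $f$ is a combination of the $F_i$ with constant coefficients, the coordinates
    of $t_i$. The family $t$ may be any family of fixed vectors, which avoids computing in the
    abstract basis [vbasis]. *)
Lemma polynomial_map_sum (T : vectType K) (I : finType) (F : I -> U -> K)
    (t : I -> T) (f : U -> T) :
  (forall i, polynomial_fun (F i)) -> (forall u, f u = \sum_i F i u *: t i) ->
  polynomial_map f.
Proof.
move=> FP fE i.
suff [P PE] : polynomial_fun
    (fun u => \sum_k F k u * coord (vbasis {:T}) i (t k)).
  exists P => u; rewrite -PE fE linear_sum; apply: eq_bigr => k _.
  by rewrite linearZ.
apply: polynomial_fun_sum => k; apply: polynomial_funM => //.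
exact: polynomial_fun_cst.
Qed.

End PolynomialFunctions.

(** * The bilinear form and real Gram matrices *)

Section Dot.
Variable K : comPzRingType.

Lemma dotE n (u v : 'rV[K]_n) : dot u v = (u *m v^T) 0 0.
Proof. by rewrite /dot !mxE; apply: eq_bigr => k _; rewrite !mxE. Qed.

Lemma dotC n (u v : 'rV[K]_n) : dot u v = dot v u.
Proof. by apply: eq_bigr => k _; rewrite mulrC. Qed.

Lemma dotBB n (u v : 'rV[K]_n) :
  dot (u - v) (u - v) = dot u u - dot u v *+ 2 + dot v v.
Proof.
rewrite mulr2n {2}(dotC u v) !dotE linearB /= mulmxBl !mulmxBr !mxE.
by rewrite opprB opprD !addrA [LHS]addrAC.
Qed.

End Dot.

Section Gram.
Variables (F : realFieldType) (m n : nat).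

Lemma dot_self_eq0 (u : 'rV[F]_n) : dot u u = 0 -> u = 0.
Proof.
move/eqP; rewrite psumr_eq0 => [/allP u0|i _]; last by rewrite -expr2 sqr_ge0.
apply/rowP => k; rewrite mxE; apply/eqP.
by have := u0 k (mem_index_enum _); rewrite mulf_eq0 orbb.
Qed.

(** If $v A A^T = 0$ then $\langle vA, vA\rangle = v A A^T v^T = 0$, so $vA = 0$ by positivity and
    $v = 0$ by independence of the rows. *)
Lemma gram_unitmx (A : 'M[F]_(m, n)) : row_free A -> A *m A^T \in unitmx.
Proof.
move=> freeA; rewrite -row_free_unit -kermx_eq0; apply/rowV0P => v /sub_kermxP vG.
apply/eqP; rewrite -(mulmx_free_eq0 v freeA); apply/eqP/dot_self_eq0.
by rewrite dotE trmx_mul !mulmxA -(mulmxA v) vG mul0mx mxE.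
Qed.

End Gram.

(** * Matrix form of the data, with [edge_mx] as $P$ and [cedge_mx] as its complexification *)

Section Theta.
Variables (R : realType) (p : 'I_4 -> 'rV[R]_4).

Definition edge_mx : 'M[R]_(3, 4) := \matrix_i tnth (p123 p) i.
Definition cedge_mx : 'M[R[i]]_(3, 4) := map_mx (real_complex R) edge_mx.

Lemma row_cedge_mx i : row i cedge_mx = cplx (tnth (p123 p) i).
Proof. by rewrite -map_row rowK. Qed.

Lemma cplx_lift (j : 'I_3) : cplx (p (lift ord0 j)) = row j cedge_mx.
Proof. by rewrite row_cedge_mx tnth_mktuple. Qed.

Lemma dot_cplx (u v : 'rV[R]_4) : dot (cplx u) (cplx v) = (dot u v)%:C%C.
Proof.
by rewrite /dot rmorph_sum; apply: eq_bigr => k _; rewrite !mxE -rmorphM.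
Qed.

Lemma cedge_mul_trE (w : 'rV[R[i]]_4) j :
  (cedge_mx *m w^T) j 0 = dot w (row j cedge_mx).
Proof. by rewrite dotC dotE -row_mul [RHS]mxE. Qed.

Lemma GE : G p = edge_mx *m edge_mx^T.
Proof.
apply/matrixP => i j; rewrite !mxE; apply: eq_bigr => k _.
by rewrite !mxE.
Qed.

Lemma row_free_edge_mx : free (p123 p) -> row_free edge_mx.
Proof.
move=> /freeP p_free; rewrite -kermx_eq0; apply/rowV0P => v /sub_kermxP v0.
apply/rowP => i; rewrite mxE.
apply: (p_free (v 0)) => {i}; rewrite -[RHS]v0 mulmx_sum_row.
by apply: eq_bigr => i _; rewrite rowK -tnth_nth.
Qed.

(** [VC] is spanned by the complexified [vbasis] of $V$, not directly by the $p_i$. Each of those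
    basis vectors is a real combination of the $p_i$, and substituting these into a complex
    combination gives $c$. *)
Lemma VC_edge (w : 'rV[R[i]]_4) : w \in VC p -> exists c, w = c *m cedge_mx.
Proof.
suff VCsub v : v \in V p -> exists c, cplx v = c *m cedge_mx.
  pose X := map_tuple (@cplx R 4) (vbasis (V p)).
  move=> wX; rewrite (coord_span (X := X) wX).
  have X_edge (k : 'I_(\dim (V p))) : exists c, X`_k = c *m cedge_mx.
    have /mapP[v v_V ->] : X`_k \in X by rewrite -tnth_nth mem_tnth.
    by apply: VCsub; apply: vbasis_mem.
  have [c cE] := fin_all_exists X_edge.
  exists (\sum_k coord X k w *: c k).
  rewrite mulmx_suml; apply: eq_bigr => k _.
  by rewrite -scalemxAl -cE.
move=> /coord_span ->.
exists (map_mx (real_complex R) (\row_k coord (p123 p) k v)).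
rewrite -map_mxM mulmx_sum_row /cplx; congr map_mx.
by apply: eq_bigr => i _; rewrite rowK mxE -tnth_nth.
Qed.

Lemma WvecE Q : Wvec p Q = (invGC p *m b p Q)^T *m cedge_mx.
Proof.
rewrite mulmx_sum_row; apply: eq_bigr => i _.
by rewrite row_cedge_mx !mxE scaler_suml.
Qed.

Hypothesis p_free : free (p123 p).

(** Invertibility is proved over [R], where the form is positive definite, and carried to [R[i]] by
    the ring morphism; over [R[i]] the bilinear form has isotropic vectors. *)
Lemma invGCK : invGC p *m (cedge_mx *m cedge_mx^T) = 1%:M.
Proof.
rewrite map_trmx -map_mxM -GE -map_mxM mulVmx ?map_mx1 // GE.
exact/gram_unitmx/row_free_edge_mx.
Qed.

Lemma invGCKV : cedge_mx *m cedge_mx^T *m invGC p = 1%:M.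
Proof. exact: mulmx1C invGCK. Qed.

(** * The two composites are identities *)

Hypothesis p_0 : p ord0 = 0.

Lemma Theta0 (x : subvs_of (VC p) * R[i]^o) :
  Theta x 0 ord0 = dot (vsval x.1) (vsval x.1) + x.2 :> R[i].
Proof. by rewrite mxE /Rj p_0 /cplx map_mx0 subr0. Qed.

Lemma b_Theta (x : subvs_of (VC p) * R[i]^o) :
  b p (Theta x) = cedge_mx *m (vsval x.1)^T.
Proof.
apply/colP => j; rewrite cedge_mul_trE mxE Theta0 mxE /Rj dotBB.
rewrite -dot_cplx -row_cedge_mx cplx_lift.
set ww := dot _ (vsval _); set pp := dot (row _ _) _; set wp := dot _ (row _ _).
have -> : ww + x.2 + pp - (ww - wp *+ 2 + pp + x.2) = wp *+ 2 by ring.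
by rewrite -(mulr_natl wp) mulKf // pnatr_eq0.
Qed.

Lemma ThetaK : cancel (@Theta R p) (@ThetaInv R p).
Proof.
move=> x; have [c xE] := VC_edge (subvsP x.1).
have invb : invGC p *m b p (Theta x) = c^T.
  by rewrite b_Theta xE trmx_mul !mulmxA -(mulmxA (invGC p)) invGCK mul1mx.
rewrite [x in RHS]surjective_pairing; congr pair.
  by apply: val_inj; rewrite /= WvecE invb trmxK -xE.
(* Here $b^T G^{-1} b = (P w^T)^T c^T = w (cP)^T = w w^T$. *)
rewrite /DeltaA -mulmxA invb Theta0 b_Theta trmx_mul trmxK -mulmxA.
by rewrite -trmx_mul -xE -dotE addrC addKr.
Qed.

Lemma ThetaInvK : cancel (@ThetaInv R p) (@Theta R p).
Proof.
move=> Q.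
have edgeW : cedge_mx *m (Wvec p Q)^T = b p Q.
  by rewrite WvecE trmx_mul trmxK !mulmxA invGCKV mul1mx.
have dotW : dot (Wvec p Q) (Wvec p Q) = ((b p Q)^T *m invGC p *m b p Q) 0 0.
  (* Viewing the entry of a 1 x 1 matrix as a trace allows transposing $(G^{-1}b)^T b$ into $b^T
     G^{-1} b$. *)
  rewrite dotE {1}WvecE -[in LHS]mulmxA edgeW -[LHS]trace_mx11 -mxtrace_tr.
  by rewrite trace_mx11 trmx_mul trmxK mulmxA.
apply/rowP => j; rewrite mxE /Rj /= dotBB dotW /DeltaA.
set q := (_ *m b p Q) 0 0.
case: (unliftP ord0 j) => [k|] ->; last first.
  rewrite p_0 /cplx map_mx0 !dotE trmx0 !mulmx0 mxE mul0rn.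
  ring.
(* Since $\langle W, p_j\rangle = b_j$, the factor 2 from expanding the square cancels the $1/2$ in
   $b_j$. *)
rewrite cplx_lift -cedge_mul_trE edgeW row_cedge_mx dot_cplx.
rewrite [b p Q k 0]mxE -(mulr_natl (_ * _)) mulrA mulfV ?pnatr_eq0 // mul1r.
ring.
Qed.

(** * Polynomiality of the map and of its inverse *)

Lemma Theta_polynomial : polynomial_map (@Theta R p).
Proof.
pose F j (x : subvs_of (VC p) * R[i]^o) : R[i] := Rj j x.1 + x.2.
apply: (@polynomial_map_sum _ _ _ _ F (delta_mx 0)) => [j|x]; last first.
  by rewrite [LHS]row_sum_delta; apply: eq_bigr => j _; rewrite mxE.
apply: polynomial_funD; last by apply: polynomial_fun_scalar.
(* The entries of $w - p_j$ are affine in $x$, and $R_j$ is the sum of their squares. *)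
have coordP k : polynomial_fun (fun x : subvs_of (VC p) * R[i]^o =>
    (vsval x.1 - cplx (p j)) 0 k).
  have [||P PE] := @polynomial_funB _ _
    (fun x : subvs_of (VC p) * R[i]^o => vsval x.1 0 k) (fun=> cplx (p j) 0 k).
  - by apply: polynomial_fun_scalar => a x y; rewrite !mxE.
  - exact: polynomial_fun_cst.
  by exists P => x; rewrite -PE !mxE.
by apply: polynomial_fun_sum => k; apply: polynomial_funM.
Qed.

Lemma ThetaInv_polynomial : polynomial_map (@ThetaInv R p).
Proof.
have bP k : polynomial_fun (fun Q => b p Q k 0).
  have entryP j : polynomial_fun (fun Q : 'rV[R[i]]_4 => Q 0 j).
    by apply: polynomial_fun_scalar => a u v; rewrite !mxE.
  suff [P PE] : polynomial_fun (fun Q : 'rV[R[i]]_4 => 2^-1 * (Q 0 ord0 +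
      (dot (tnth (p123 p) k) (tnth (p123 p) k))%:C%C - Q 0 (lift ord0 k))).
    by exists P => Q; rewrite -PE mxE.
  apply: polynomial_funM; first exact: polynomial_fun_cst.
  apply: polynomial_funB => //; apply: polynomial_funD => //.
  exact: polynomial_fun_cst.
have DeltaP : polynomial_fun (DeltaA p).
  suff [P PE] : polynomial_fun (fun Q : 'rV[R[i]]_4 => Q 0 ord0 -
      \sum_i (\sum_k b p Q k 0 * invGC p k i) * b p Q i 0).
    exists P => Q; rewrite -PE /DeltaA mxE; congr (_ - _).
    apply: eq_bigr => i _; rewrite mxE; congr (_ * _).
    by apply: eq_bigr => k _; rewrite mxE.
  apply: polynomial_funB.
    by apply: polynomial_fun_scalar => a u v; rewrite !mxE.
  apply: polynomial_fun_sum => i; apply: polynomial_funM => //.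
  apply: polynomial_fun_sum => k; apply: polynomial_funM => //.
  exact: polynomial_fun_cst.
have pVC i : cplx (tnth (p123 p) i) \in VC p.
  by apply/cplx_cspan/memv_span/mem_tnth.
(* The inverse is a combination of ten fixed vectors: $(p_i, 0)$, repeated for each $k$, with
   coefficient $(G^{-1})_{ik} b_k$, and $(0, 1)$ with coefficient $\Delta_A$. *)
pose F (o : 'I_3 * 'I_3 + unit) Q :=
  if o is inl ik then invGC p ik.1 ik.2 * b p Q ik.2 0 else DeltaA p Q.
pose t (o : 'I_3 * 'I_3 + unit) : subvs_of (VC p) * R[i]^o :=
  if o is inl ik then (Subvs (pVC ik.1), 0) else (0, 1).
apply: (@polynomial_map_sum _ _ _ _ F t) => [[ik|_]|Q] //=.
  by apply: polynomial_funM => //; apply: polynomial_fun_cst.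
rewrite big_sumType /= (big_pred1 tt) => [|[]] //.
(* The nine terms are regrouped as a double sum, to match [Wvec]. The term along $(0, 1)$ vanishes
   in the first component, those along the $(p_i, 0)$ in the second. *)
pose z i k : subvs_of (VC p) * R[i]^o := F (inl (i, k)) Q *: t (inl (i, k)).
rewrite (eq_bigr (fun ik => z ik.1 ik.2)) => [|[]//].
rewrite -(pair_bigA _ z) /=; congr pair.
  apply: val_inj; rewrite /= scaler0 addr0.
  rewrite (big_morph fst (id1 := 0) (op1 := +%R)) //= linear_sum.
  apply: eq_bigr => i _.
  rewrite (big_morph fst (id1 := 0) (op1 := +%R)) //= linear_sum.
  by apply: eq_bigr.
rewrite [RHS]addrC (big_morph snd (id1 := 0) (op1 := +%R)) //= big1 => [|i _].
  by rewrite addr0 /GRing.scale /= mulr1.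
rewrite (big_morph snd (id1 := 0) (op1 := +%R)) //= big1 // => k _.
by rewrite scaler0.
Qed.

End Theta.

Theorem proposition3p9 (R : realType) (p : 'I_4 -> 'rV[R]_4)
    (p_0 : p ord0 = 0) (p_free : free (p123 p)) :
  [/\ polynomial_isomorphism (@Theta R p),
      cancel (@Theta R p) (@ThetaInv R p),
      cancel (@ThetaInv R p) (@Theta R p) &
      forall (w : subvs_of (VC p)) (S : R[i]), DeltaA p (Theta (w, S)) = S].
Proof.
have TK := ThetaK p_free p_0; have TIK := ThetaInvK p_free p_0.
split=> // [|w S]; last by have [_ ->] := TK (w, S).
split; first exact: Theta_polynomial.
by exists (@ThetaInv R p); split=> //; apply: ThetaInv_polynomial.
Qed.
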